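(* Let $G$ be a connected simple graph on $n\ge 5$ vertices with minimum degree $\delta(G)\ge 2$. If \[ q(G) \ge \frac{10}{n-1} + 2n - 6, \] then $G$ is pancyclic unless $G$ is bipartite or $G = K_3\vee 4K_1$.
   Context: All graphs are finite, simple and undirected. $q(G)$ denotes the signless Laplacian spectral radius of $G$, i.e., the largest eigenvalue of $Q(G)=D(G)+A(G)$, where $D(G)$ is the diagonal matrix of vertex degrees and $A(G)$ the adjacency matrix. A graph on $n$ vertices is pancyclic if it contains a cycle of every length $l$ with $3\le l\le n$. $K_3$ is the complete graph on $3$ vertices, $4K_1$ is the edgeless graph on $4$ vertices, and $G\vee H$ (the join) is obtained from the disjoint union of $G$ and $H$ by adding all edges between a vertex of $G$ and a vertex of $H$. *)

(* Defs.v *)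
From HB Require Import structures.
From mathcomp Require Import all_boot all_order all_algebra.
From mathcomp Require Import complex polyrcf.
From mathcomp Require Import boolp classical_sets reals.

Set Implicit Arguments.
Unset Strict Implicit.
Unset Printing Implicit Defensive.

Import Order.TTheory GRing.Theory Num.Theory.

Local Open Scope ring_scope.

Record sgraph := SGraph {
  vertex :> finType;
  adj : rel vertex;
  adj_sym : symmetric adj;
  adj_irrefl : irreflexive adj }.

Section Graph.

Variable G : sgraph.

Definition degree (v : G) : nat := #|[set w | adj v w]|.

(* Every degree is smaller than #|G|, so the default value is never attained
   when G has a vertex. *)
Definition min_degree : nat := \big[minn/#|G|]_(v : G) degree v.

Definition connected_graph : Prop :=
  (0 < #|G|)%N /\ forall x y : G, connect (@adj G) x y.

Definition bipartite : Prop :=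
  exists A : {set G}, forall x y : G, adj x y -> (x \in A) != (y \in A).

Definition has_cycle (l : nat) : Prop :=
  (3 <= l)%N /\ exists2 c : seq G, ucycle (@adj G) c & size c = l.

Definition pancyclic : Prop :=
  forall l : nat, (3 <= l <= #|G|)%N -> has_cycle l.

End Graph.

Definition graph_iso (G H : sgraph) : Prop :=
  exists2 f : G -> H, bijective f & forall x y : G, adj (f x) (f y) = adj x y.

Section Examples.

Variable n : nat.

Definition complete_rel : rel 'I_n := fun x y => x != y.

Fact complete_sym : symmetric complete_rel.
Proof. by move=> x y; rewrite /complete_rel eq_sym. Qed.

Fact complete_irrefl : irreflexive complete_rel.
Proof. by move=> x; rewrite /complete_rel eqxx. Qed.

Definition complete_graph : sgraph := SGraph complete_sym complete_irrefl.

Definition edgeless_rel : rel 'I_n := fun _ _ => false.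

Fact edgeless_sym : symmetric edgeless_rel.
Proof. by []. Qed.

Fact edgeless_irrefl : irreflexive edgeless_rel.
Proof. by []. Qed.

Definition edgeless_graph : sgraph := SGraph edgeless_sym edgeless_irrefl.

End Examples.

Section Join.

Variables G H : sgraph.

Definition join_rel : rel (G + H)%type := fun x y =>
  match x, y with
  | inl a, inl b => adj a b
  | inr a, inr b => adj a b
  | _, _ => true
  end.

Fact join_sym : symmetric join_rel.
Proof. by move=> [a|a] [b|b] //=; apply: adj_sym. Qed.

Fact join_irrefl : irreflexive join_rel.
Proof. by move=> [a|a] /=; apply: adj_irrefl. Qed.

Definition join_graph : sgraph := SGraph join_sym join_irrefl.

End Join.

Section SignlessLaplacian.

Variables (R : realType) (G : sgraph).

(* Rows and columns are indexed by the vertices through enum_val; the spectrum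
   does not depend on this enumeration. *)
Definition adjacency_mx : 'M[R]_#|G| :=
  \matrix_(i, j) (adj (enum_val i) (enum_val j))%:R.

Definition degree_mx : 'M[R]_#|G| :=
  diag_mx (\row_i (degree (enum_val i))%:R).

Definition signless_laplacian : 'M[R]_#|G| := degree_mx + adjacency_mx.

(* The supremum is a maximum as soon as G has a vertex, see
   signless_radius_max below. *)
Definition signless_radius : R :=
  sup [set a : R | eigenvalue signless_laplacian a]%classic.

End SignlessLaplacian.

Section SignlessRadiusMax.

Variable R : realType.

Local Notation toC := (real_complex R).

Lemma symmetric_eigenvalue n (A : 'M[R]_n) :
  (0 < n)%N -> A^T = A -> exists a, eigenvalue A a.
Proof.
case: n A => // n A _ symA.
pose B := map_mx toC A.
have Breal : B \is a mxOver Num.real.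
  by apply/mxOverP => i j; rewrite mxE complex_real.
have Bsym : B \is symmetricmx.
  apply/is_hermitianmxP; rewrite expr0 scale1r map_mx_id //.
  by apply/matrixP => i j; rewrite !mxE -{1}symA mxE.
have Bherm : B \is hermsymmx := realsym_hermsym Bsym Breal.
have /hermitian_normalmx/orthomx_spectralP eqB := Bherm.
have /mxOverP/(_ ord0 ord0)/complex_realP[a ea] :=
  hermitian_spectral_diag_real Bherm.
have eigB : eigenvalue B (toC a) = eigenvalue A a := eigenvalue_map _ A a.
exists a; rewrite -eigB; rewrite /toC in ea *; rewrite -ea.
set P := spectralmx B in eqB; have Pu : P \in unitmx := spectral_unit B.
apply/eigenvalueP; exists (row ord0 P).
  rewrite {1}eqB -row_mul !mulmxA mulmxV // mul1mx.
  by apply/rowP => j; rewrite mul_diag_mx !mxE.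
have : ~~ (row ord0 (1%:M : 'M[R[i]%C]_n.+1) == 0).
  apply/eqP => /rowP/(_ ord0); rewrite !mxE eqxx /= => /eqP.
  by rewrite oner_eq0.
by apply: contraNneq => r0; rewrite -(mulmxV Pu) row_mul r0 mul0mx.
Qed.

Lemma signless_laplacian_sym (G : sgraph) :
  (signless_laplacian R G)^T = signless_laplacian R G.
Proof.
apply/matrixP => i j; rewrite !mxE adj_sym; congr (_ + _).
by rewrite eq_sym; case: eqP => // ->.
Qed.

Lemma signless_radius_max (G : sgraph) : (0 < #|G|)%N ->
  eigenvalue (signless_laplacian R G) (signless_radius R G) /\
  (forall a, eigenvalue (signless_laplacian R G) a -> a <= signless_radius R G).
Proof.
move=> G0; have [a0 ea0] := symmetric_eigenvalue G0 (signless_laplacian_sym G).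
rewrite /signless_radius; set A := signless_laplacian R G in ea0 *.
pose s := rootsR (char_poly A).
have sP a : (a \in s) = eigenvalue A a.
  rewrite eigenvalue_root_char.
  by rewrite -roots_on_rootsR ?monic_neq0 ?char_poly_monic // in_itv.
pose m := \big[Num.max/a0]_(x <- s) x.
have em : eigenvalue A m.
  rewrite /m big_seq; elim/big_ind: _ => // [x y ex ey|x]; last by rewrite sP.
  by rewrite /Num.max; case: ifP.
have lem a : eigenvalue A a -> a <= m.
  by rewrite -sP => sa; exact: (@le_bigmax_seq _ _ _ _ _ _ xpredT id sa isT).
suff -> : sup [set a : R | eigenvalue A a]%classic = m by [].
apply/le_anti/andP; split; first by apply: ge_sup => //; exists a0.
by apply: ub_le_sup => //; exists m.
Qed.

End SignlessRadiusMax.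

(* Main.v *)
(** Testing the signless Laplacian against the positive vector of degrees gives
    [q <= max_v (d v + avg of d over the neighbours of v)]; the maximum is
    attained only if all these row bounds agree, since [G] is connected.  With
    minimum degree at least 2 this turns the hypothesis on [q] into: the
    complement of [G] has at most [2n - 8] edges.  In particular [G] is never
    bipartite.

    Bondy-Chvatal closure: repeatedly joining nonadjacent [u], [v] with
    [d u + d v >= n] does not affect hamiltonicity.  In a closed noncomplete
    graph a nonadjacent pair of maximal degree sum, with [k] the smaller degree,
    forces at least [k (2n - 3k - 1) / 2] non-edges (Chvatal).  This leaves only
    complements that are a single clique [K_(k+1)] with [n = 2k + 1] and
    [k = 3] or [k = 4]; the last one, [K_4 v 5K_1], has too small a [q].

    Finally, a Hamiltonian cycle containing an edge whose ends have degree sum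
    more than [n] yields cycles of all lengths (Bondy), and such an edge exists
    by averaging. *)
Require Import Defs.
From mathcomp Require Import all_boot all_order all_algebra.
From mathcomp Require Import reals.
From mathcomp Require Import zify ring lra.

Set Implicit Arguments.
Unset Strict Implicit.
Unset Printing Implicit Defensive.

(** * Cycles as vertex sequences: rerouting along chords, closure, Bondy's argument *)

Section Cycles.

Variables (T : finType).
Implicit Types (e : rel T) (f : nat -> T).

Definition deg e x := #|[set y | e x y]|.

(** Vertex sequences are functions on [nat] whose values from [n] on are irrelevant; rerouting a
    cycle is then composition with an index map. *)
Definition inj_below n f :=
  forall i j, i < n -> j < n -> f i = f j -> i = j.

Definition path_below e n f := forall i, i.+1 < n -> e (f i) (f i.+1).

Definition cyclic_seq e l f :=
  [/\ inj_below l f, path_below e l f & e (f l.-1) (f 0)].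

Definition cyc e l := exists f, cyclic_seq e l f.

Lemma deg_sum e n f x : #|T| = n -> inj_below n f ->
  deg e x = \sum_(0 <= i < n) e x (f i).
Proof.
move=> <- finj; rewrite big_mkord /deg -sum1dep_card big_mkcond /=.
have ginj : injective (fun i : 'I_#|T| => f i).
  by move=> i j /finj H; apply/val_inj/H; apply: ltn_ord.
rewrite (reindex (fun i : 'I_#|T| => f i)) /=.
  by apply: eq_bigr => i _; case: e.
by apply: onW_bij; apply: inj_card_bij => //; rewrite card_ord.
Qed.

(** Rotation starting just after position [a]: the chosen edge becomes the closing one, and the rest
    is a path joining its ends. *)
Lemma cut_cyclic_seq e n f a : cyclic_seq e n f -> a < n ->
  exists g, [/\ inj_below n g, path_below e n g,
    g n.-1 = f a & g 0 = f (if a.+1 < n then a.+1 else 0)].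
Proof.
move=> [finj fp fc] an.
pose r i := if i + a.+1 < n then i + a.+1 else i + a.+1 - n.
exists (f \o r); split.
- move=> i j ilt jlt /= /finj; rewrite /r.
  by case: ifP; case: ifP => *; lia.
- move=> i ilt /=; rewrite /r; case: ifP => h1; case: ifP => h2; try lia.
  + by rewrite addSn; apply: fp; lia.
  + have -> : i + a.+1 = n.-1 by lia.
    by have -> : i.+1 + a.+1 - n = 0 by lia.
  + have -> : i.+1 + a.+1 - n = (i + a.+1 - n).+1 by lia.
    by apply: fp; lia.
- by rewrite /= /r; case: ifP => ?; congr f; lia.
- by rewrite /= /r add0n; case: ifP => ?; congr f; lia.
Qed.

(* The cycle f 0, ..., f k, f (n - 1), ..., f j. *)
Lemma crossing_cycle e n f j k : symmetric e ->
  inj_below n f -> path_below e n f -> k < j < n ->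
  e (f 0) (f j) -> e (f n.-1) (f k) -> cyc e (k.+1 + (n - j)).
Proof.
move=> es finj fp /andP[kj jn] ej ek.
pose r i := if i <= k then i else n + k - i.
exists (f \o r); split.
- move=> i i' hi hi' /= /finj; rewrite /r.
  by case: ifP; case: ifP => *; lia.
- move=> i hi /=; rewrite /r; case: ifP => h1; case: ifP => h2; try lia.
  + by apply: fp; lia.
  + have -> : i = k by lia.
    have -> : n + k - k.+1 = n.-1 by lia.
    by rewrite es.
  + rewrite es; have -> : n + k - i = (n + k - i.+1).+1 by lia.
    by apply: fp; lia.
- rewrite /= /r; case: ifP => h; first by lia.
  have -> : n + k - (k.+1 + (n - j)).-1 = j by lia.
  by rewrite /= es.
Qed.

(* The cycle f 0, f j, ..., f k, f (n - 1). *)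
Lemma chord_cycle e n f j k : symmetric e ->
  inj_below n f -> path_below e n f -> e (f n.-1) (f 0) ->
  0 < j -> j <= k -> k < n.-1 ->
  e (f 0) (f j) -> e (f n.-1) (f k) -> cyc e (k - j + 3).
Proof.
move=> es finj fp ec j0 jk kn ej ek.
pose r i := if i == 0 then 0 else if i <= k - j + 1 then i + j - 1 else n.-1.
exists (f \o r); split.
- move=> i i' hi hi' /= /finj; rewrite /r.
  by do !case: ifP; move=> *; lia.
- move=> i hi; rewrite /r /=; case: (eqVneq i 0) => [->|i0].
    by rewrite ifT; [have -> : 1 + j - 1 = j by lia | lia].
  rewrite ifT; last by lia.
  have [h|h] := leqP i.+1 (k - j + 1).
    have -> : i.+1 + j - 1 = (i + j - 1).+1 by lia.
    by apply: fp; lia.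
  have -> : i + j - 1 = k by lia.
  by rewrite es.
- rewrite /= /r; case: ifP => h; first by lia.
  by case: ifP => h2 //; lia.
Qed.

Lemma sum_nat_last (F : nat -> nat) a n : a < n ->
  \sum_(a <= i < n) F i = \sum_(a <= i < n.-1) F i + F n.-1.
Proof. by case: n => // n an; rewrite big_nat_recr. Qed.

(** Each index [i] is charged at most once, by [F] at [i] or by [H] at [i + s]. This bounds the
    degrees of the two ends of a path together when no matched pair of chords exists. *)
Lemma sumb_le (F H : nat -> bool) s a b :
  (forall i, a <= i < b -> F i -> H (i + s) -> False) ->
  \sum_(a <= i < b) F i + \sum_(a + s <= i < b + s) H i <= b - a.
Proof.
move=> FH; rewrite big_addn addnK -big_split /=.
rewrite -[b - a]muln1 -sum_nat_const_nat big_nat [X in _ <= X]big_nat.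
apply: leq_sum => i; by move/FH; case: (F i); case: (H _) => //; case.
Qed.

(** Ore's argument: without crossing chords from [f 0] to [f i.+1] and from [f n.-1] to [f i], the
    first neighbourhood, shifted by one, is disjoint from the second inside [n.-1] positions, so the
    degree sum is below [n]. *)
Lemma crossing_ham e n f : symmetric e -> irreflexive e ->
  #|T| = n -> 2 < n -> inj_below n f -> path_below e n f ->
  n <= deg e (f 0) + deg e (f n.-1) -> cyc e n.
Proof.
move=> es ei hn n2 finj fp hd.
case: (boolP [exists i : 'I_n,
    [&& i.+1 < n, e (f 0) (f i.+1) & e (f n.-1) (f i)]]).
  move=> /existsP[[i ilt] /= /and3P[h1 h2 h3]].
  have -> : n = i.+1 + (n - i.+1) by lia.
  by apply: crossing_cycle h2 h3 => //; lia.
move=> /existsPn hno.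
have := @sumb_le (fun i => e (f n.-1) (f i)) (fun i => e (f 0) (f i)) 1 0 n.-1.
rewrite subn0 !addn1 prednK ?(ltn_trans _ n2) //.
have -> : \sum_(1 <= i < n) e (f 0) (f i) = deg e (f 0).
  by rewrite (deg_sum _ _ hn finj) [RHS]big_ltn ?ei //; lia.
have -> : \sum_(0 <= i < n.-1) e (f n.-1) (f i) = deg e (f n.-1).
  by rewrite (deg_sum _ _ hn finj) [RHS]sum_nat_last ?ei ?addn0 //; lia.
move=> H; suff: deg e (f n.-1) + deg e (f 0) <= n.-1 by lia.
apply: H => i /andP[_ hi] hF hH.
have ilt : i < n by lia.
rewrite addn1 in hH; have := hno (Ordinal ilt); rewrite /= hF hH andbT; lia.
Qed.

Definition add_edge e u v : rel T := fun x y =>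
  [|| e x y, (x == u) && (y == v) | (x == v) && (y == u)].

(** A Hamiltonian cycle with a step outside [e] uses the added edge there; cutting it leaves a
    Hamiltonian path of [e] between [u] and [v], to which [crossing_ham] applies. *)
Lemma closure_step e u v : symmetric e -> irreflexive e -> 2 < #|T| ->
  #|T| <= deg e u + deg e v -> cyc (add_edge e u v) #|T| -> cyc e #|T|.
Proof.
move=> es ei; move En : #|T| => n n2 hd [f fc].
have [finj fp fl] := fc.
case: (boolP [forall i : 'I_n, e (f i) (f (if i.+1 < n then i.+1 else 0))]).
  move=> /forallP H; exists f; split => //.
    move=> i hi; have ilt : i < n by lia.
    by have := H (Ordinal ilt); rewrite /= hi.
  have nlt : n.-1 < n by lia.
  by have := H (Ordinal nlt); rewrite /= prednK ?ltnn //; lia.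
move=> /forallPn[[a an] /= ha].
have [g [ginj gp g1 g0]] := cut_cyclic_seq fc an.
have uv : g n.-1 = u /\ g 0 = v \/ g n.-1 = v /\ g 0 = u.
  have : add_edge e u v (g n.-1) (g 0).
    rewrite g1 g0; case: ifP => h; first exact: fp.
    by have -> : a = n.-1 by lia.
  rewrite /add_edge {1}g1 {1}g0 (negbTE ha) /=.
  by case/orP => /andP[/eqP -> /eqP ->]; [left|right].
apply: (crossing_ham (f := g)) => //; last first.
  by case: uv => -[-> ->] //; rewrite addnC.
(* The path cannot use the added edge: [u] and [v] sit at positions [0] and [n.-1], which are not
   consecutive since [2 < n]. *)
move=> i hi; have := gp i hi; rewrite /add_edge => /or3P[//|/andP[]|/andP[]];
  move=> /eqP h1 /eqP h2; exfalso.
all: case: uv => -[k1 k2]; move: h1 h2; rewrite -k1 -k2 => /ginj h1 /ginj h2.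
all: by have := h1 ltac:(lia) ltac:(lia); have := h2 ltac:(lia) ltac:(lia); lia.
Qed.

(* Bondy: the two families of chords at the ends of a Hamiltonian edge are
   matched so that each matched pair closes a cycle of length l. *)
Lemma ham_edge_pancyclic e n f l : symmetric e -> irreflexive e ->
  #|T| = n -> inj_below n f -> path_below e n f -> e (f n.-1) (f 0) ->
  n < deg e (f 0) + deg e (f n.-1) -> 2 < l <= n -> cyc e l.
Proof.
move=> es ei hn finj fp fc hd /andP[l3 ln].
(* First family: the chords end [l - 3] apart, and [chord_cycle] has length [l]. *)
case: (boolP [exists j : 'I_n, [&& 0 < j, j < n - l + 2, e (f 0) (f j)
   & e (f n.-1) (f (j + (l - 3)))]]).
  move=> /existsP[[j jn] /= /and4P[j0 j1 h1 h2]].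
  have -> : l = j + (l - 3) - j + 3 by lia.
  by apply: (@chord_cycle e n f) => //; lia.
move=> /existsPn no1.
(* Second family: crossing chords, whose cycle skips the [n - l] vertices strictly between their
   ends. *)
case: (boolP [exists j : 'I_n, [&& 0 < j, j < l - 1,
   e (f 0) (f (j + (n - l + 1))) & e (f n.-1) (f j)]]).
  move=> /existsP[[j jn] /= /and4P[j0 j1 h1 h2]].
  have -> : l = j.+1 + (n - (j + (n - l + 1))) by lia.
  by apply: (@crossing_cycle e n f) => //; lia.
move=> /existsPn no2.
pose A i := e (f 0) (f i); pose B i := e (f n.-1) (f i).
have H1 : \sum_(1 <= i < n - l + 2) A i + \sum_(l - 2 <= i < n.-1) B i
    <= n - l + 1.
  have := @sumb_le A B (l - 3) 1 (n - l + 2).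
  have -> : 1 + (l - 3) = l - 2 by lia.
  have -> : n - l + 2 + (l - 3) = n.-1 by lia.
  have -> : n - l + 2 - 1 = n - l + 1 by lia.
  apply=> i /andP[i0 i1] a b; have ilt : i < n by lia.
  by have := no1 (Ordinal ilt); rewrite /= i0 i1 [e _ _]a [e _ _]b.
have H2 : \sum_(1 <= i < l - 1) B i + \sum_(n - l + 2 <= i < n) A i
    <= l - 2.
  have := @sumb_le B A (n - l + 1) 1 (l - 1).
  have -> : 1 + (n - l + 1) = n - l + 2 by lia.
  have -> : l - 1 + (n - l + 1) = n by lia.
  have -> : l - 1 - 1 = l - 2 by lia.
  apply=> i /andP[i0 i1] b a; have ilt : i < n by lia.
  by have := no2 (Ordinal ilt); rewrite /= i0 i1 [e _ _]a [e _ _]b.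
have dA : deg e (f 0) = \sum_(1 <= i < n - l + 2) A i
                        + \sum_(n - l + 2 <= i < n) A i.
  rewrite (deg_sum _ _ hn finj) big_ltn ?ei ?add0n; last by lia.
  by rewrite -big_cat_nat //; lia.
(* Index [0] accounts for the [1]; the ranges overlap at [l - 2], harmless in an upper bound. With
   [H1] and [H2] the degree sum is at most [1 + (n - l + 1) + (l - 2) = n]. *)
have dB : deg e (f n.-1) <= 1 + \sum_(1 <= i < l - 1) B i
                        + \sum_(l - 2 <= i < n.-1) B i.
  rewrite (deg_sum _ _ hn finj) (@big_cat_nat _ _ _ 1) //=; last by lia.
  rewrite big_nat1 -addnA leq_add ?leq_b1 //.
  rewrite (@big_cat_nat _ _ _ (l - 1)) //=; try lia.
  rewrite leq_add2l.
  have [El|lltn] := eqVneq l n.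
    have -> : l - 1 = n.-1 by lia.
    rewrite sum_nat_last ?ei; last by lia.
    by rewrite [X in X + _]big_geq.
  rewrite sum_nat_last; last by lia.
  rewrite ei addn0 [X in _ <= X]big_ltn; last by lia.
  have -> : (l - 2).+1 = l - 1 by lia.
  exact: leq_addl.
lia.
Qed.

(** Summing the degrees of both ends over the edges of the Hamiltonian cycle counts every degree
    twice, so some edge of the cycle has degree sum above the average bound [n]. *)
Lemma ham_pancyclic e l : symmetric e -> irreflexive e ->
  #|T| ^ 2 < 2 * \sum_x deg e x -> cyc e #|T| -> 2 < l <= #|T| -> cyc e l.
Proof.
move=> es ei hd; move En : #|T| => n; rewrite En in hd.
move=> [f fc] hl; have [finj fp fl] := fc.
pose nx i := if i.+1 < n then i.+1 else 0.
suff [a ha] : exists a : 'I_n, n < deg e (f (nx a)) + deg e (f a).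
  have [g [ginj gp g1 g0]] := cut_cyclic_seq fc (ltn_ord a).
  apply: (@ham_edge_pancyclic e n g l) => //; last by rewrite g1 g0.
  rewrite g1 g0; case: ifP => h; first exact: fp.
  by have -> : nat_of_ord a = n.-1 by have := ltn_ord a; lia.
apply/existsP; apply: contraLR hd => /existsPn no; rewrite -leqNgt.
have sumf : \sum_x deg e x = \sum_(i < n) deg e (f i).
  rewrite (reindex (fun i : 'I_n => f i)) //.
  apply: onW_bij; apply: inj_card_bij; last by rewrite card_ord En.
  by move=> i j /finj H; apply/val_inj/H; apply: ltn_ord.
have sumg : \sum_x deg e x = \sum_(i < n) deg e (f (nx i)).
  rewrite (reindex (fun i : 'I_n => f (nx i))) //.
  apply: onW_bij; apply: inj_card_bij; last by rewrite card_ord En.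
  move=> [i hi] [j hj] /= /finj; rewrite /nx => H; apply/val_inj => /=.
  by move: H; case: ifP; case: ifP => *; lia.
rewrite mul2n -addnn {1}sumg sumf -big_split /=.
apply: (@leq_trans (\sum_(i < n) n)); last by rewrite sum_nat_const card_ord.
by apply: leq_sum => i _; have := no i; rewrite -leqNgt.
Qed.

End Cycles.

(** * Degree counting and the Hamiltonicity dichotomy *)

Section Hamilton.

Variables (T : finType).
Implicit Types (e : rel T).

Lemma card_sumb (A : {set T}) : \sum_x (x \in A) = #|A|.
Proof.
by rewrite -sum1_card [in RHS]big_mkcond; apply: eq_bigr => x _; case: ifP.
Qed.

Definition nonadj e x := [set y | (y != x) && ~~ e x y].

Lemma deg_nonadj e x : irreflexive e -> deg e x + #|nonadj e x| = #|T|.-1.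
Proof.
move=> ei; have -> : nonadj e x = ~: (x |: [set y | e x y]).
  by apply/setP => y; rewrite !inE negb_or.
by have := cardsC (x |: [set y | e x y]); rewrite cardsU1 inE ei /= /deg; lia.
Qed.

Lemma deg_sumE e x : deg e x = \sum_y e x y.
Proof.
rewrite /deg -sum1dep_card big_mkcond /=.
by apply: eq_bigr => y _; case: e.
Qed.

(** Ordering the vertices by rank splits the ordered adjacent pairs into two halves exchanged by
    symmetry. *)
Lemma handshake e : symmetric e -> irreflexive e -> ~~ odd (\sum_x deg e x).
Proof.
move=> es ei; pose r (x : T) : nat := enum_rank x.
pose S := \sum_x \sum_y (r x < r y) * e x y.
suff -> : \sum_x deg e x = S + S by rewrite addnn odd_double.
have {2}-> : S = \sum_x \sum_y (r y < r x) * e x y.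
  rewrite /S exchange_big; apply: eq_bigr => x _; apply: eq_bigr => y _.
  by rewrite es.
rewrite -big_split; apply: eq_bigr => x _; rewrite deg_sumE -big_split.
apply: eq_bigr => y _ /=; case: (ltngtP (r x) (r y)) => [||E];
  rewrite ?addn0 ?mul1n //.
by rewrite (enum_rank_inj (val_inj E)) ei.
Qed.

Lemma deg_add_edge e u v x : irreflexive e -> u != v -> ~~ e u v -> ~~ e v u ->
  deg (add_edge e u v) x = deg e x + (x == u) + (x == v).
Proof.
move=> ei uv euv evu; rewrite !deg_sumE -addnA.
have -> : (x == u) + (x == v)
  = \sum_y ((x == u) && (y == v) + (x == v) && (y == u)).
  rewrite big_split /=; congr (_ + _).
    rewrite (bigD1 v) //= eqxx andbT big1 ?addn0 // => y /negbTE ->.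
    by rewrite andbF.
  rewrite (bigD1 u) //= eqxx andbT big1 ?addn0 // => y /negbTE ->.
  by rewrite andbF.
rewrite -big_split /=; apply: eq_bigr => y _; rewrite /add_edge.
case: (eqVneq x u) => [->|xu] /=; case: (eqVneq y v) => [->|yv] /=.
- by rewrite (negbTE uv) (negbTE euv).
- by rewrite (negbTE uv); case: (e u y).
- by rewrite (eq_sym v) (negbTE uv) andbF; case: (e x v).
- case: (eqVneq y u) => [->|] /=; last by rewrite andbF; case: (e x y).
  case: (eqVneq x v) => [->|] /=; first by rewrite (negbTE evu).
  by case: (e x u).
Qed.

Lemma complete_cyc e : 2 < #|T| -> (forall x y, x != y -> e x y) -> cyc e #|T|.
Proof.
move=> n2 he; have /card_gt0P[x0 _] : 0 < #|T| by apply: leq_trans n2.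
have finj : inj_below #|T| (nth x0 (enum T)).
  move=> i j hi hj /eqP; rewrite nth_uniq -?cardE ?enum_uniq //.
  by move/eqP.
exists (nth x0 (enum T)); split => //.
  by move=> i hi; apply: he; apply/eqP => /finj; lia.
by apply: he; apply/eqP => /finj; lia.
Qed.

(** The join of a complete graph on the complement of [B] with an edgeless graph on [B]. *)
Definition split_complete e (B : {set T}) :=
  forall x y, e x y = (x != y) && ~~ ((x \in B) && (y \in B)).

(** For a nonadjacent pair [u], [v] of maximal degree sum, non-neighbours of [v] have degree at most
    [deg e u], and those of [u] at most [deg e v]. Many vertices thus miss many others, and the
    bound on non-edges is met only with equality. *)
Lemma closed_split_complete e n : symmetric e -> irreflexive e -> #|T| = n ->
  (forall x, 1 < deg e x) -> n * n.-1 + 16 <= \sum_x deg e x + 4 * n ->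
  (forall u v, u != v -> ~~ e u v -> deg e u + deg e v < n) ->
  (exists u v, u != v /\ ~~ e u v) ->
  exists k (B : {set T}), [/\ k = 3 \/ k = 4, n = 2 * k + 1, #|B| = k.+1,
    split_complete e B & \sum_x deg e x + 4 * n = n * n.-1 + 16].
Proof.
move=> es ei hn hdeg hsum hclosed [u0 [v0 [uv0 euv0]]].
pose P := [pred p : T * T | (p.1 != p.2) && ~~ e p.1 p.2].
pose S (p : T * T) := deg e p.1 + deg e p.2.
have [u [v [uv euv dle hmax]]] : exists u v, [/\ u != v, ~~ e u v,
    deg e u <= deg e v & forall x y, x != y -> ~~ e x y ->
      deg e x + deg e y <= deg e u + deg e v].
  have P0 : P (u0, v0) by rewrite /= uv0 euv0.
  case: (arg_maxnP S P0) => -[u v] /= /andP[uv euv] hm.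
  have hm' x y : x != y -> ~~ e x y -> deg e x + deg e y <= deg e u + deg e v.
    by move=> h1 h2; apply: (hm (x, y)); rewrite /= h1 h2.
  case: (leqP (deg e u) (deg e v)) => h; first by exists u, v.
  exists v, u; split; rewrite 1?eq_sym 1?es // 1?ltnW // => x y h1 h2.
  by rewrite addnC (addnC (deg e v)) addnC; apply: hm'.
set k := deg e u in dle hmax; have kn := hclosed u v uv euv; rewrite -/k in kn.
pose h x := #|nonadj e x|.
have dh x : deg e x + h x = n.-1 by rewrite /h deg_nonadj // hn.
have hsumh : \sum_x deg e x + \sum_x h x = n * n.-1.
  rewrite -big_split /= (eq_bigr (fun=> n.-1)) => [|x _]; last exact: dh.
  by rewrite sum_nat_const hn.
pose A := nonadj e v; pose B := u |: nonadj e u.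
have cA : #|A| = h v by [].
have cB : #|B| = (h u).+1 by rewrite cardsU1 inE eqxx.
have hA x : x \in A -> n.-1 - k <= h x.
  rewrite inE => /andP[h1 h2]; have := hmax x v h1.
  by rewrite es => /(_ h2); have := dh x; lia.
have hB x : x \in B -> k <= h x.
  rewrite !inE => /orP[/eqP ->|/andP[h1 h2]].
    by have := dh u; rewrite -/k; lia.
  have := hmax u x; rewrite eq_sym => /(_ h1 h2).
  by have := dh x; lia.
have hlow : k * #|B| + (n.-1 - 2 * k) * #|A| <= \sum_x h x.
  have -> : k * #|B| + (n.-1 - 2 * k) * #|A|
    = \sum_x (k * (x \in B) + (n.-1 - 2 * k) * (x \in A)).
    by rewrite big_split /= -!big_distrr /= !card_sumb.
  apply: leq_sum => x _; have := hA x; have := hB x.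
  by case: (x \in A); case: (x \in B) => /=; lia.
have dhu := dh u; have dhv := dh v; rewrite -/k in dhu.
have hu : h u = n.-1 - k by lia.
have k2 : 1 < k by apply: hdeg.
have hv : k <= h v by lia.
have hlow2 : k * (n - k) + (n.-1 - 2 * k) * k <= \sum_x h x.
  apply: leq_trans hlow; rewrite cB cA hu leq_add //.
    by rewrite leq_mul2l; apply/orP; right; lia.
  by rewrite leq_mul2l; apply/orP; right.
have key : k * (n - k) + (n.-1 - 2 * k) * k + 16 <= 4 * n by lia.
(* With [n = 2 * k + 1 + m], [key] says that [(k - 3)(k - 4) + (2k - 4) m] is at most [0] over the
   integers; as [k] is at least [2], this forces [m = 0] and [k] in [{3, 4}]. *)
have knk : (k = 3 /\ n = 7) \/ (k = 4 /\ n = 9).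
  have [m Em] : exists m, n = 2 * k + 1 + m by exists (n - (2 * k + 1)); lia.
  have E1 : n - k = k + 1 + m by lia.
  have E2 : n.-1 - 2 * k = m by lia.
  rewrite E1 E2 in key; clear -key k2 Em.
  have k5 : k <= 4 by nia.
  have : k = 2 \/ k = 3 \/ k = 4 by lia.
  by case=> [|[|]] E; rewrite E in key Em *; lia.
have n2k : n = 2 * k + 1 by lia.
have cBk : #|B| = k.+1 by lia.
(* Both cases have [4 * n - 16 = k * k.+1], so the lower bound is tight at every vertex: [k]
   non-neighbours inside [B], none outside. *)
have sumh : \sum_x h x = \sum_x k * (x \in B).
  have -> : \sum_x k * (x \in B) = k * k.+1.
    by rewrite -big_distrr /= card_sumb cBk.
  apply/eqP; rewrite eqn_leq; apply/andP; split.
    by case: knk => -[E1 E2]; rewrite E1 E2 in hsum hsumh *; lia.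
  by apply: leq_trans hlow; rewrite cBk leq_addr.
have hE x : h x = k * (x \in B).
  have le y : k * (y \in B) <= h y.
    by have := hB y; case: (y \in B); lia.
  apply/eqP; rewrite eqn_leq le andbT leqNgt; apply/negP => lt.
  suff : \sum_y k * (y \in B) < \sum_y h y by lia.
  rewrite (bigD1 x) //= [X in _ < X](bigD1 x) //=.
  by rewrite -addSn leq_add // leq_sum.
exists k, B; split => //; first by lia.
  have out x y : x != y -> x \notin B -> e x y.
    move=> xy xB; have := hE x; rewrite (negbTE xB) muln0 => /eqP.
    rewrite cards_eq0 => /eqP/setP/(_ y); rewrite !inE eq_sym xy /=.
    by move/negbFE.
  move=> x y; case: (eqVneq x y) => [->|xy]; first by rewrite ei.
  case: (boolP (x \in B)) => xB /=; last exact: out.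
  case: (boolP (y \in B)) => yB /=; last by rewrite es out // eq_sym.
  have sub : nonadj e x \subset B :\ x.
    apply/subsetP => z; rewrite inE in_setD1 => /andP[zx ez]; rewrite zx /=.
    by apply: contraNT ez => zB; rewrite es out.
  have : nonadj e x = B :\ x.
    apply/eqP; rewrite eqEcard sub /=.
    have := hE x; rewrite /h => ->; have := cardsD1 x B.
    by rewrite xB cBk; lia.
  by move/setP/(_ y); rewrite [in RHS]inE yB !inE eq_sym xy /= => /negbTE.
by lia.
Qed.

(** Induction on the number of non-edges: join a pair of degree sum at least [n] while one exists; a
    closed graph is complete or extremal. *)
Lemma ham_or_split_complete e n : symmetric e -> irreflexive e -> #|T| = n ->
  2 < n ->
  (forall x, 1 < deg e x) -> n * n.-1 + 16 <= \sum_x deg e x + 4 * n ->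
  cyc e n \/
  exists k (B : {set T}), [/\ k = 3 \/ k = 4, n = 2 * k + 1, #|B| = k.+1,
    split_complete e B & \sum_x deg e x + 4 * n = n * n.-1 + 16].
Proof.
move=> es ei hn n2.
have [m] := ubnP (n * n - \sum_x deg e x); elim: m e es ei => // m IH e es ei.
move=> hm hdeg hsum.
case: (boolP [exists p : T * T, [&& p.1 != p.2, ~~ e p.1 p.2
    & n <= deg e p.1 + deg e p.2]]).
  move=> /existsP[[u v] /= /and3P[uv euv huv]]; left.
  have dE x := deg_add_edge x ei uv euv (etrans (congr1 negb (es v u)) euv).
  have sE : \sum_x deg (add_edge e u v) x = \sum_x deg e x + 2.
    under eq_bigr do rewrite dE -addnA.
    rewrite big_split big_split -[2]/(1 + 1) /=; congr (_ + (_ + _)).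
      by rewrite (bigD1 u) //= eqxx big1 // => x /negbTE ->.
    by rewrite (bigD1 v) //= eqxx big1 // => x /negbTE ->.
  have sn : \sum_x deg (add_edge e u v) x <= n * n.
    rewrite -{1}hn -sum_nat_const leq_sum // => x _.
    by rewrite -hn max_card.
  have as' : symmetric (add_edge e u v).
    by move=> x y; rewrite /add_edge es; congr orb;
      rewrite orbC ![_ && (y == _)]andbC.
  have ai : irreflexive (add_edge e u v).
    move=> x; rewrite /add_edge ei /=.
    by case: (eqVneq x u) => [->|_] /=; rewrite ?(negbTE uv) ?andbF.
  (* The extremal alternative cannot arise after adding an edge: it demands equality, while the
     degree sum has just grown by [2]. *)
  have [||||[k [B [_ _ _ _]]]] := IH (add_edge e u v) as' ai; try lia.
  - by move=> x; rewrite dE -addnA (leq_trans (hdeg x)) // leq_addr.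
  - by rewrite -hn; apply: closure_step; rewrite // hn.
move=> /existsPn hno.
case: (boolP [exists p : T * T, (p.1 != p.2) && ~~ e p.1 p.2]).
  move=> /existsP[[u0 v0] /= /andP[uv0 euv0]]; right.
  apply: closed_split_complete => //; last by exists u0, v0.
  move=> u v uv euv; have := hno (u, v); rewrite /= uv euv /=; lia.
move=> /existsPn hno2; left; rewrite -hn; apply: complete_cyc; rewrite ?hn //.
by move=> x y xy; have := hno2 (x, y); rewrite /= xy /= negbK.
Qed.

End Hamilton.

(** * Transfer to the graph definitions *)

Lemma has_cycle_cyc (G : sgraph) l : 2 < l -> cyc (@adj G) l -> has_cycle G l.
Proof.
move=> l3 [f [finj fp fc]]; split=> //.
exists (mkseq f l); last by rewrite size_mkseq.
apply/andP; split; last first.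
  apply/(uniqP (f 0)) => i j; rewrite !inE size_mkseq => hi hj.
  by rewrite !nth_mkseq //; apply: finj.
case: l l3 finj fp fc => // l l3 _ fp fc.
rewrite /mkseq /= rcons_path; apply/andP; split.
  apply/(pathP (f 0)) => i; rewrite size_map size_iota => hi.
  rewrite (nth_map 0) ?size_iota // nth_iota // add1n.
  case: i hi => [|i] hi /=; first exact: fp.
  rewrite (nth_map 0) ?size_iota ?nth_iota ?add1n //; try lia.
  by apply: fp; lia.
rewrite (last_nth (f 0)) size_map size_iota /=.
case: l l3 fp fc => // l _ _ fc; rewrite -[f 0 :: _]/(map f (iota 0 l.+2)).
by rewrite (nth_map 0) ?size_iota // nth_iota.
Qed.

Lemma degree_ge_min (G : sgraph) (v : G) : min_degree G <= degree v.
Proof.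
rewrite /min_degree; have : v \in index_enum G by exact: mem_index_enum.
elim: (index_enum G) => // w s IH; rewrite inE big_cons geq_min.
by case/orP => [/eqP <-|/IH ->]; rewrite ?leqnn ?orbT.
Qed.

(** Adjacency depends only on membership in [B] and on equality, so any bijection sending [B] to the
    edgeless side works. *)
Lemma split_complete_iso (G : sgraph) (B : {set G}) : #|G| = 7 -> #|B| = 4 ->
  split_complete (@adj G) B ->
  graph_iso G (join_graph (complete_graph 3) (edgeless_graph 4)).
Proof.
move=> n7 B4 hB; have C3 : #|~: B| = 3 by rewrite cardsCs setCK n7 B4.
have ltB x : x \in B -> index x (enum B) < 4.
  by move=> xB; rewrite -B4 cardE index_mem mem_enum.
have ltC x : x \notin B -> index x (enum (~: B)) < 3.
  by move=> xB; rewrite -C3 cardE index_mem mem_enum inE.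
pose f (x : G) : 'I_3 + 'I_4 := if x \in B
  then inr (inord (index x (enum B))) else inl (inord (index x (enum (~: B)))).
have finj : injective f.
  move=> x y; rewrite /f.
  case: (boolP (x \in B)) => xB; case: (boolP (y \in B)) => yB //;
    move=> [] /(congr1 val) /=.
    rewrite !inordK ?ltB // => /(congr1 (nth x (enum B))).
    by rewrite !nth_index ?mem_enum.
  rewrite !inordK ?ltC // => /(congr1 (nth x (enum (~: B)))).
  by rewrite !nth_index ?mem_enum ?inE.
exists f.
  by apply: inj_card_bij => //; rewrite card_sum !card_ord n7.
move=> x y; rewrite hB.
have -> : (x != y) = (f x != f y) by rewrite (inj_eq finj).
rewrite /f; case: (x \in B); case: (y \in B) => //=.
  by rewrite andbF.
by rewrite andbT.
Qed.

(** * Row bounds for the signless Laplacian *)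

(** The row bound at a vertex of degree [d], with [N = n - 1], neighbour degree sum [S] and total
    degree [M]. For small [d] the bound [S <= d * N] suffices strictly; otherwise the bound through
    [M] leaves slack at least [j * (N + t)] with [j = N - d], so equality forces [d = N]. *)
Lemma degree_arith (N d S M : nat) : 4 <= N -> 1 < d <= N ->
  S <= d * N -> S + d + 2 * (N - d) <= M -> M + 4 * N.+1 <= N.+1 * N + 14 ->
  N * (d * d + S) <= (2 * N * N + 10 - 4 * N) * d /\
  (N * (d * d + S) = (2 * N * N + 10 - 4 * N) * d -> d = N).
Proof.
move=> N4 /andP[d2 dN] h1 h2 h3.
have NN : 4 * N <= N * N by rewrite leq_mul2r N4 orbT.
have [lt|ge] := ltnP (d * N) (N * N + 10 - 4 * N).
  have H : N * (d * d + S) < (2 * N * N + 10 - 4 * N) * d.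
    apply: (@leq_ltn_trans (d * (d * N + N * N))); first by nia.
    by rewrite [X in _ < X]mulnC ltn_pmul2l; lia.
  by split; [exact: ltnW | lia].
have [j Ej] : exists j, N = d + j by exists (N - d); lia.
have hS : S + d + 2 * j <= N * N + 10 - 3 * N by lia.
have [t Et] : exists t, d * N = N * N + 10 - 4 * N + t.
  by exists (d * N - (N * N + 10 - 4 * N)); lia.
have hx : N * (d * d + S) + j * (N + t) <= (2 * N * N + 10 - 4 * N) * d.
  have := leq_mul (leqnn N) hS.
  have [w Ew] : exists w, w = N * N + 10 - 4 * N by exists (N * N + 10 - 4 * N).
  have -> : N * N + 10 - 3 * N = w + N by lia.
  have -> : 2 * N * N + 10 - 4 * N = w + N * N by lia.
  rewrite -Ew in Et; rewrite Ej in Et *; clear -Et; nia.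
split; first by apply: leq_trans hx; rewrite leq_addr.
move=> E; case: j Ej hx {hS} => [|j] Ej hx; first by lia.
by move: hx; rewrite E; nia.
Qed.

Import Order.TTheory GRing.Theory Num.Theory.
Local Open Scope ring_scope.

(* At a vertex maximizing |y v| / x v, for y an eigenvector, both the bound at
   v and the maximality of the ratio at the neighbours of v are tight. *)
Lemma collatz_wielandt_eq (R : realType) (G : sgraph) (x : G -> R) (a b : R) :
  connected_graph G -> eigenvalue (signless_laplacian R G) a -> b <= a ->
  (forall v, 0 < x v) ->
  (forall v, (degree v)%:R * x v + \sum_(w | adj v w) x w <= b * x v) ->
  forall v, (degree v)%:R * x v + \sum_(w | adj v w) x w = b * x v.
Proof.
move=> [n0 conn] /eigenvalueP[z zE z0] ba x0 xb.
pose y (v : G) : R := `|z ord0 (enum_rank v)|.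
have yE v : b * y v <= (degree v)%:R * y v + \sum_(w | adj v w) y w.
  have E : a * z ord0 (enum_rank v) = (degree v)%:R * z ord0 (enum_rank v)
      + \sum_(w | adj v w) z ord0 (enum_rank w).
    have /rowP/(_ (enum_rank v)) := zE; rewrite !mxE => <-.
    rewrite (reindex_onto (@enum_rank G) (@enum_val G (mem G))) /=; last first.
      by move=> i _; apply: enum_valK.
    under eq_bigl do rewrite enum_rankK eqxx.
    under eq_bigr => w _ do rewrite !mxE !enum_rankK mulrDr.
    rewrite big_split /=; congr (_ + _).
      rewrite (bigD1 v) //= eqxx mulr1n mulrC big1 ?addr0 // => w wv.
      by rewrite (inj_eq enum_rank_inj) (negbTE wv) mulr0n mulr0.
    rewrite [RHS]big_mkcond /=; apply: eq_bigr => w _.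
    by rewrite adj_sym; case: adj; rewrite ?mulr1 ?mulr0.
  apply: (@le_trans _ _ (`|a * z ord0 (enum_rank v)|)).
    rewrite normrM ler_wpM2r ?normr_ge0 //.
    exact: le_trans ba (ler_norm _).
  rewrite E (le_trans (ler_normD _ _)) // lerD //.
    by rewrite normrM normr_nat.
  exact: ler_norm_sum.
have [i0 zi0] : exists i, z ord0 i != 0.
  apply/existsP; apply: contraNT z0 => /existsPn H; apply/eqP/rowP => i.
  by rewrite mxE; apply/eqP; have := H i; rewrite negbK.
pose v0 : G := enum_val i0.
have y0 : 0 < y v0 by rewrite /y enum_valK normr_gt0.
pose m := [arg max_(v > v0) (y v / x v)]%O.
have mP v : y v / x v <= y m / x m.
  by rewrite /m; case: arg_maxP => // i _; apply.
set r : R := y m / x m in mP.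
have r0 : 0 < r by apply: lt_le_trans (mP v0); rewrite divr_gt0.
have yr v : y v <= r * x v by rewrite -ler_pdivrMr.
have step v : y v = r * x v ->
   (degree v)%:R * x v + \sum_(w | adj v w) x w = b * x v
   /\ forall w, adj v w -> y w = r * x w.
  move=> Ev; have := yE v; rewrite Ev => H1.
  have H2 : \sum_(w | adj v w) y w <= r * \sum_(w | adj v w) x w.
    by rewrite mulr_sumr ler_sum.
  have H3 : r * ((degree v)%:R * x v + \sum_(w | adj v w) x w) <= r * (b * x v).
    by rewrite ler_pM2l.
  have H4 : (degree v)%:R * (r * x v) + r * \sum_(w | adj v w) x w
     = r * ((degree v)%:R * x v + \sum_(w | adj v w) x w) by ring.
  have H5 : b * (r * x v) = r * (b * x v) by ring.
  split.
    by apply/eqP; rewrite -(inj_eq (mulfI (lt0r_neq0 r0))) eq_le H3 /=; lra.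
  have : \sum_(w | adj v w) (r * x w - y w) == 0.
    rewrite sumrB -mulr_sumr eq_le; apply/andP; split; lra.
  rewrite psumr_eq0 => [/allP H w vw|w _]; last by rewrite subr_ge0.
  have := H w (mem_index_enum w); rewrite vw /= subr_eq0 => /eqP <- //.
(* The maximal ratio spreads from [m] along paths to every vertex. *)
move=> v; suff : y v = r * x v by case/step.
have Em : y m = r * x m by rewrite /r divfK // gt_eqF.
have /connectP[p mp ->] := conn m v.
have spread q u : y u = r * x u -> path (@adj G) u q ->
    y (last u q) = r * x (last u q).
  elim: q u => //= w q IH u Eu /andP[uw].
  by apply: IH; have [_ /(_ w uw)] := step u Eu.
exact: spread.
Qed.

(** With too small a degree sum, [degree_arith] bounds every row for the degree vector; the
    hypothesis on [q] then makes all rows tight, so [G] is complete and its degree sum is too large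
    after all. *)
Lemma degree_sum_lower (R : realType) (G : sgraph) : (4 < #|G|)%N ->
  connected_graph G -> (forall v : G, (1 < degree v)%N) ->
  10 / (#|G|%:R - 1) + 2 * #|G|%:R - 6 <= signless_radius R G ->
  (#|G| * #|G|.-1 + 16 <= \sum_(v : G) deg (@adj G) v + 4 * #|G|)%N.
Proof.
move=> n5 conn d2 hq; rewrite leqNgt; apply/negP => lt.
have n0 : (0 < #|G|)%N by lia.
have [eq _] := signless_radius_max R n0.
have par := handshake (@adj_sym G) (@adj_irrefl G).
move En : #|G| => n in n5 hq lt n0.
set M := (\sum_(v : G) deg (@adj G) v)%N in lt par.
(* Both sides are even, so the strict inequality gains one more unit. *)
have lt' : (M + 4 * n <= n * n.-1 + 14)%N.
  have : ~~ odd (n * n.-1).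
    by rewrite oddM; case: (n) n0 => // k _ /=; case: odd.
  have : ~~ odd (4 * n) by rewrite oddM.
  lia.
pose N := n.-1; have nN : n = N.+1 by rewrite prednK.
pose d (v : G) := degree v; pose S v := (\sum_(w | adj v w) d w)%N.
have dh v : (d v + #|nonadj (@adj G) v| = N)%N.
  by rewrite /N -En; apply: deg_nonadj; apply: adj_irrefl.
have arith v : (N * (d v * d v + S v) <= (2 * N * N + 10 - 4 * N) * d v)%N /\
    ((N * (d v * d v + S v) = (2 * N * N + 10 - 4 * N) * d v)%N -> d v = N).
  apply: (@degree_arith N (d v) (S v) M); rewrite -?nN //; try lia.
  - by rewrite d2 /=; have := dh v; lia.
  - have -> : (d v * N = \sum_(w | adj v w) N)%N.
      by rewrite sum_nat_const /d /degree cardsE.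
    by apply: leq_sum => w _; have := dh w; lia.
  - have -> : (N - d v)%N = #|nonadj (@adj G) v| by have := dh v; lia.
    (* The total degree splits into the neighbours of [v], [v] itself, and its non-neighbours, each
       of degree at least [2]. *)
    rewrite /M (bigID (adj v)) /= -addnA leq_add2l (bigD1 v) ?adj_irrefl //=.
    rewrite leq_add2l mulnC -sum_nat_const.
    rewrite [X in (_ <= X)%N](eq_bigl (mem (nonadj (@adj G) v))); last first.
      by move=> w; rewrite !inE andbC.
    by apply: leq_sum => w _; apply: d2.
pose b : R := 10 / (n%:R - 1) + 2 * n%:R - 6.
have N0 : 0 < N%:R :> R by rewrite ltr0n; lia.
have bN : N%:R * b = (2 * N * N + 10 - 4 * N)%:R.
  rewrite natrB ?natrD ?natrM; last by nia.
  by rewrite /b nN -natr1; field; rewrite addrAC subrr add0r lt0r_neq0.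
have castE v : (d v)%:R * (d v)%:R + \sum_(w | adj v w) (d w)%:R
     = (d v * d v + S v)%:R :> R.
  by rewrite natrD natrM natr_sum.
have eqall v : d v = N.
  apply: (proj2 (arith v)); apply/eqP; rewrite -(eqr_nat R) !natrM.
  rewrite -[X in X * (d v)%:R]bN -mulrA (inj_eq (mulfI (lt0r_neq0 N0))).
  rewrite -castE; apply/eqP.
  apply: (collatz_wielandt_eq (x := fun v => (d v)%:R) conn eq hq).
    by move=> w; rewrite ltr0n; apply: ltnW.
  move=> w; rewrite castE -(ler_pM2l N0) mulrA bN -!natrM ler_nat.
  exact: (proj1 (arith w)).
have : M = (n * N)%N.
  by rewrite /M (eq_bigr (fun=> N)) ?sum_nat_const ?En // => v _; apply: eqall.
rewrite /N; lia.
Qed.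

(** A positive vector with all row bounds strictly below [53 / 4] contradicts the equality that
    [collatz_wielandt_eq] would give. *)
Lemma split_complete9_radius (R : realType) (G : sgraph) (B : {set G}) :
  #|G| = 9%N -> connected_graph G -> #|B| = 5%N -> split_complete (@adj G) B ->
  signless_radius R G < 10 / (9 - 1) + 2 * 9 - 6.
Proof.
move=> n9 conn B5 hB; rewrite ltNge; apply/negP => hq.
have n0 : (0 < #|G|)%N by rewrite n9.
have [eq _] := signless_radius_max R n0.
have C4 : #|~: B| = 4%N by rewrite cardsCs setCK n9 B5.
(* Any ratio close to 11 / 25 makes both row bounds smaller than 53 / 4. *)
pose x (v : G) := if v \in B then 11%N else 25%N.
have sx : (\sum_v x v = 155)%N.
  rewrite (bigID (mem B)) /=.
  rewrite (eq_bigr (fun=> 11%N)) => [|v vB]; last by rewrite /x vB.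
  rewrite [X in (_ + X)%N](eq_bigr (fun=> 25%N)) => [|v vB]; last first.
    by rewrite /x (negbTE vB).
  rewrite !sum_nat_const B5.
  have -> : #|[pred i | i \notin B]| = #|~: B|.
      by apply: eq_card => i; rewrite !inE.
  by rewrite C4.
have rowE v : (degree v * x v + \sum_(w | adj v w) x w
    = if v \in B then 144 else 330)%N.
  have [vB|vB] := boolP (v \in B); rewrite [x v]/x ?vB ?(negbTE vB).
    have E : adj v =1 [pred w | w \notin B].
      move=> w; rewrite hB vB /=; case: (eqVneq v w) => [<-|] //=.
      by rewrite vB.
    have -> : degree v = 4%N.
      by rewrite -C4; apply: eq_card => w; rewrite !inE E.
    rewrite (eq_bigl _ _ E) (eq_bigr (fun=> 25%N)) => [|w wB]; last first.
      by rewrite /x (negbTE wB).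
    rewrite sum_nat_const.
    have -> : #|[pred i | i \notin B]| = #|~: B|.
      by apply: eq_card => i; rewrite !inE.
    by rewrite C4.
  have E : adj v =1 [pred w | w != v].
    by move=> w; rewrite hB (negbTE vB) /= andbT eq_sym.
  have -> : degree v = 8%N.
    have -> : degree v = #|[set~ v]| by apply: eq_card => w; rewrite !inE E.
    by rewrite cardsC1 n9.
  have := sx; rewrite (bigD1 v) //= [x v]/x (negbTE vB) (eq_bigl _ _ E) /=.
  by set s := bigop _ _ _; lia.
have le v : (degree v)%:R * (x v)%:R + \sum_(w | adj v w) (x w)%:R
    < (10 / (9 - 1) + 2 * 9 - 6) * (x v)%:R :> R.
  have -> : 9 - 1 = 8 :> R by ring.
  by rewrite -natr_sum -natrM -natrD rowE /x; case: ifP => _; lra.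
have /card_gt0P[v _] := n0.
have := collatz_wielandt_eq (x := fun v => (x v)%:R) conn eq hq _
  (fun v => ltW (le v)).
move=> /(_ _ v) E; have := le v; rewrite E ?ltxx // => w.
by rewrite /x; case: ifP.
Qed.

Theorem theorem3p3 (R : realType) (G : sgraph) (n : nat)
    (hn : #|G| = n) (hn5 : (5 <= n)%N)
    (hconn : connected_graph G)
    (hdeg : (2 <= min_degree G)%N)
    (hq : signless_radius R G >= 10 / (n%:R - 1) + 2 * n%:R - 6) :
  pancyclic G \/ bipartite G \/
  graph_iso G (join_graph (complete_graph 3) (edgeless_graph 4)).
Proof.
have d2 (v : G) : (1 < degree v)%N := leq_trans hdeg (degree_ge_min v).
subst n; have hs := degree_sum_lower hn5 hconn d2 hq.
have es := @adj_sym G; have ei := @adj_irrefl G.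
have n2 : (2 < #|G|)%N by apply: leq_trans hn5.
have [ham|[k [B [k34 nk Bk hB _]]]] :=
    ham_or_split_complete es ei (erefl _) n2 d2 hs; [left|right; right].
  move=> l hl; apply: has_cycle_cyc; first by case/andP: hl.
  (* The degree sum is at least [n^2 - 5n + 16], and twice this exceeds [n^2] by at least
     [(n - 5)^2 + 7]. *)
  by apply: ham_pancyclic => //; nia.
case: k34 nk Bk => -> nk Bk; first exact: split_complete_iso hB.
have := split_complete9_radius R nk hconn Bk hB; rewrite ltNge.
by rewrite nk in hq; rewrite hq.
Qed.
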